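(* Let $n\ge 3$ be an integer and let $\mathscr{A}$ and $\mathscr{B}$ be two cross-intersecting antichains on $\mathbb{N}_n$. Then $$|\mathscr{A}|+|\mathscr{B}|\le \binom{n}{\lfloor (n+1)/2\rfloor}+\binom{n}{\lceil (n+1)/2\rceil}.$$ Furthermore, equality holds if and only if $\{\mathscr{A},\mathscr{B}\}=\left\{\binom{\mathbb{N}_n}{\lfloor (n+1)/2\rfloor},\binom{\mathbb{N}_n}{\lceil (n+1)/2\rceil}\right\}$.
   Context: For a positive integer $n$, $\mathbb{N}_n=\{1,2,\ldots,n\}$, and for $0\le k\le n$, $\binom{\mathbb{N}_n}{k}$ denotes the collection of all $k$-element subsets of $\mathbb{N}_n$. An antichain (or Sperner family) on $\mathbb{N}_n$ is a collection $\mathscr{A}$ of subsets of $\mathbb{N}_n$ such that $X\not\subseteq Y$ for all distinct $X,Y\in\mathscr{A}$. Two families $\mathscr{A},\mathscr{B}\subseteq 2^{\mathbb{N}_n}$ are cross-intersecting if $A\cap B\neq\emptyset$ for all $A\in\mathscr{A}$ and all $B\in\mathscr{B}$. *)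

(* Defs.v *)
From mathcomp Require Import all_boot.

Set Implicit Arguments.
Unset Strict Implicit.
Unset Printing Implicit Defensive.

(* The ground set {1, ..., n} is represented by 'I_n = {0, ..., n-1}. *)

Definition antichain (T : finType) (F : {set {set T}}) : Prop :=
  {in F &, forall X Y : {set T}, X != Y -> ~~ (X \subset Y)}.

Definition cross_intersecting (T : finType) (F G : {set {set T}}) : Prop :=
  {in F & G, forall X Y : {set T}, X :&: Y != set0}.

Definition ksubsets (T : finType) (k : nat) : {set {set T}} :=
  [set X : {set T} | #|X| == k].

(* Main.v *)
(** Let [C] consist of the complements of the members of [B]. Then [A] and [C]
    are antichains with no member of [A] inside a member of [C]; in particular
    they are disjoint. Weighing a [k]-set by [k! (n - k)!], the LYM inequality
    gives [A] and [C] together weight at most [2 n!]. At most ['C(n, n./2)] of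
    their members have size [n./2], and all others weigh at least
    [n! / 'C(n, n./2.+1)], which yields the bound. Equality forces equality in
    both LYM inequalities, so [A] and [C] are full levels, and comparing binomial
    coefficients identifies them. *)

Require Import Defs.
From mathcomp Require Import all_boot.
From mathcomp Require Import zify.

Set Implicit Arguments.
Unset Strict Implicit.
Unset Printing Implicit Defensive.

Lemma exists_subset_card (T : finType) (S : {set T}) k : k <= #|S| ->
  exists2 X : {set T}, X \subset S & #|X| = k.
Proof.
rewrite -bin_gt0 -cards_draws card_gt0 => /set0Pn[X].
by rewrite inE => /andP[XS /eqP cardX]; exists X.
Qed.

Lemma card_ksubsets (T : finType) k : #|ksubsets T k| = 'C(#|T|, k).
Proof. by rewrite -card_draws. Qed.

Lemma setC_ksubsets (T : finType) k : k <= #|T| ->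
  [set ~: X | X in ksubsets T k] = ksubsets T (#|T| - k).
Proof.
move=> lekT; apply/setP => X; rewrite -[X]setCK (mem_imset _ _ (@setC_inj _)).
rewrite !inE setCK cardsCs setCK; have := max_card X; rewrite cardsCs.
by move=> ?; apply/eqP/eqP; lia.
Qed.

(** * Binomial coefficients around the middle index *)

Lemma ltn_bin_half n k l : k < l -> l.*2 <= n -> 'C(n, k) < 'C(n, l).
Proof.
elim: l => // l IHl; rewrite ltnS => lekl le2ln.
have ltC : 'C(n, l) < 'C(n, l.+1).
  have l_le_n : l <= n by lia.
  by have := mul_bin_left n l; have := bin_gt0 n l; rewrite l_le_n; nia.
have [->//|neqkl] := eqVneq k l.
by apply: ltn_trans ltC; apply: IHl; lia.
Qed.

Lemma bin_half_succE n : 0 < n -> 'C(n, n./2.+1) = 'C(n, n.-1./2).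
Proof. by move=> n_gt0; rewrite -bin_sub; [congr 'C(n, _) |]; lia. Qed.

(** Once [n./2] is excluded, the best index left is the other middle one for odd [n], and either
    neighbour of the middle for even [n]. Reflecting large [k] to [n - k] reduces to strict growth
    on the lower half. *)
Lemma leq_bin_half_succ n k : k <= n -> k != n./2 -> 'C(n, k) <= 'C(n, n./2.+1).
Proof.
move=> lekn neqk; have n_gt0 : 0 < n by lia.
rewrite bin_half_succE //.
have [le_k|lt_k] := leqP k n./2.
  have [->//|neqk'] := eqVneq k n.-1./2.
  by apply/ltnW/ltn_bin_half; lia.
rewrite -bin_sub //.
have [->//|neqk'] := eqVneq (n - k) n.-1./2.
by apply/ltnW/ltn_bin_half; lia.
Qed.

(** The second alternative arises only for even [n]: for odd [n] it is the excluded index [n./2]. *)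
Lemma bin_half_succ_inj n k : k <= n -> k != n./2 ->
  'C(n, k) = 'C(n, n./2.+1) -> k = n./2.+1 \/ k = n.-1./2.
Proof.
move=> lekn neqk; have n_gt0 : 0 < n by lia.
rewrite bin_half_succE //.
have [le_k|lt_k] := leqP k n./2.
  have [->|neqk' eqC] := eqVneq k n.-1./2; first by right.
  suff : 'C(n, k) < 'C(n, n.-1./2) by rewrite eqC ltnn.
  by apply: ltn_bin_half; lia.
rewrite -bin_sub //.
have [?|neqk' eqC] := eqVneq (n - k) n.-1./2; first by left; lia.
suff : 'C(n, n - k) < 'C(n, n.-1./2) by rewrite eqC ltnn.
by apply: ltn_bin_half; lia.
Qed.

Lemma leq_bin_half n : 'C(n, n./2.+1) <= 'C(n, n./2) ?= iff odd n.
Proof.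
case: n => [|n] //; rewrite bin_half_succE //.
have [oddn|evenn] := boolP (odd n.+1).
  have -> : n.+1./2 = n.+1.-1./2 by lia.
  exact: leqif_refl.
split; first by apply/ltnW/ltn_bin_half; lia.
by apply/negbTE; rewrite neq_ltn ltn_bin_half //; lia.
Qed.

(** * The LYM inequality and its equality case *)

Section LYM.

Variables (T : finType) (F : {set {set T}}).
Hypothesis antiF : antichain F.
Implicit Types S X : {set T}.

(** Each summand counts the maximal chains from [set0] to [S] through [X]. An antichain meets a
    chain at most once, so the total counts the chains that meet [F]. *)
Definition lym_sum S :=
  \sum_(X in F | X \subset S) #|X|`! * (#|S| - #|X|)`!.

Lemma lym_sum_mem S : S \in F -> lym_sum S = #|S|`!.
Proof.
move=> SF; rewrite /lym_sum (bigD1 S) /=; last by rewrite SF subxx.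
rewrite subnn fact0 muln1 big1 ?addn0 // => X /andP[/andP[XF XS] neqXS].
by case/negP: (antiF XF SF neqXS).
Qed.

(** A maximal chain to [S] passes through exactly one [S :\ i]. In the sum, a proper subset [X] of
    [S] lies in [S :\ i] for [#|S| - #|X|] choices of [i], which supplies the leading factor of the
    factorial. *)
Lemma lym_sum_rec S : S \notin F -> lym_sum S = \sum_(i in S) lym_sum (S :\ i).
Proof.
move=> SF; rewrite /lym_sum.
rewrite (exchange_big_dep (fun X => (X \in F) && (X \subset S))) /=; last first.
  by move=> i X _ /andP[-> XSi]; apply: subset_trans XSi (subD1set S i).
apply: eq_bigr => X /andP[XF XS].
have neqXS : X != S by apply: contraNneq SF => <-.
have ltXS : #|X| < #|S| by apply: proper_card; rewrite properEneq neqXS.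
rewrite (eq_bigl (mem (S :\: X))); last first.
  by move=> i; rewrite XF subsetD1 XS !inE andbC.
rewrite (eq_bigr (fun=> #|X|`! * (#|S| - #|X|).-1`!)); last first.
  move=> i /setDP[iS _].
  by rewrite (cardsD1 i S) iS add1n subSKn.
rewrite sum_nat_const cardsD (setIidPr XS) mulnCA; congr (_ * _).
by rewrite -[in LHS](@prednK (#|S| - #|X|)) ?factS ?prednK ?subn_gt0.
Qed.

Lemma sum_fact_cardsD1 S : S != set0 -> \sum_(i in S) #|S :\ i|`! = #|S|`!.
Proof.
rewrite -card_gt0 => S_gt0.
rewrite (eq_bigr (fun=> #|S|.-1`!)).
  by rewrite sum_nat_const -[in RHS](prednK S_gt0) factS prednK.
by move=> i iS; rewrite (cardsD1 i S) iS.
Qed.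

Lemma lym_sum_set0_notin : set0 \notin F -> lym_sum set0 = 0.
Proof. by move=> F0; rewrite lym_sum_rec // big_set0. Qed.

Lemma lym_sum_le S : lym_sum S <= #|S|`!.
Proof.
have [k] := ubnP #|S|; elim: k S => // k IHk S /ltnSE leSk.
have [/lym_sum_mem-> //|SF] := boolP (S \in F).
have [S0|S_neq0] := eqVneq S set0.
  by rewrite S0 lym_sum_set0_notin -?S0.
rewrite lym_sum_rec // -sum_fact_cardsD1 //.
apply: leq_sum => i iS; apply: IHk.
by move: leSk; rewrite (cardsD1 i S) iS.
Qed.

(* The sets [S :\ i] inherit equality, hence each carries a full level; two
   such levels agree because they share a set avoiding both removed points. *)
Lemma lym_sum_eq S : lym_sum S = #|S|`! ->
  exists2 k, k <= #|S| & forall X, X \subset S -> (X \in F) = (#|X| == k).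
Proof.
have [b] := ubnP #|S|; elim: b S => // b IHb S /ltnSE leSb eqS.
have [SF|SF] := boolP (S \in F).
  exists #|S| => // X XS; apply/idP/eqP => [XF|cardX].
    by apply/eqP; apply: contraTT XS => neqXS; apply: antiF => //;
      apply: contraNneq neqXS => ->.
  by suff -> : X = S by []; apply/eqP; rewrite eqEcard XS cardX leqnn.
have [S0|] := eqVneq S set0.
  by move: eqS; rewrite S0 lym_sum_set0_notin -?S0 // S0 cards0.
case/set0Pn=> i0 i0S.
have S_neq0 : S != set0 by apply/set0Pn; exists i0.
have level i : i \in S -> exists2 k, k <= #|S :\ i| &
    forall X, X \subset S :\ i -> (X \in F) = (#|X| == k).
  move=> iS; apply: IHb; first by move: leSb; rewrite (cardsD1 i S) iS.
  apply/eqP; move: i iS; apply/forall_inP.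
  have /leqif_sum : forall i, i \in S -> lym_sum (S :\ i) <= #|S :\ i|`!
      ?= iff (lym_sum (S :\ i) == #|S :\ i|`!).
    by move=> i _; split=> //; apply: lym_sum_le.
  by case=> _ <-; rewrite -lym_sum_rec // sum_fact_cardsD1 // eqS.
have [k lek Fk] := level i0 i0S.
have cardSD1 i : i \in S -> #|S :\ i| = #|S|.-1.
  by move=> iS; rewrite (cardsD1 i S) iS.
rewrite cardSD1 // in lek.
have S_gt0 : 0 < #|S| by rewrite card_gt0.
exists k => [|X XS]; first by rewrite (leq_trans lek) ?leq_pred.
have [->|neqXS] := eqVneq X S.
  by rewrite (negPf SF); apply/esym/eqP; lia.
have /properP[_ [j jS jX]] : X \proper S by rewrite properEneq neqXS.
have [k' lek' Fk'] := level j jS.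
rewrite cardSD1 // in lek'.
rewrite Fk'; last by rewrite subsetD1 XS.
suff -> : k = k' by [].
have subDj : S :\ i0 :\ j \subset S :\ j by rewrite setSD ?subD1set.
have subD0 : S :\ i0 :\ j \subset S :\ i0 by rewrite subD1set.
have := cardsD1 j (S :\ i0); rewrite cardSD1 // => cardD2.
have [lekD|ltDk] := leqP k #|S :\ i0 :\ j|.
  have [Y YS cardY] := exists_subset_card lekD.
  apply/eqP; rewrite -{1}cardY -Fk' ?(subset_trans YS) //.
  by rewrite Fk ?(subset_trans YS) // cardY.
have [lekD'|ltDk'] := leqP k' #|S :\ i0 :\ j|.
  have [Y YS cardY] := exists_subset_card lekD'.
  apply/esym/eqP; rewrite -{1}cardY -Fk ?(subset_trans YS) //.
  by rewrite Fk' ?(subset_trans YS) // cardY.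
(* Both ranks now exceed [#|S :\ i0 :\ j|] and are at most [#|S|.-1]. This is absurd if [j = i0],
   and otherwise makes both equal to [#|S|.-1]. *)
by move: (j \in S :\ i0) cardD2 => [] /=; lia.
Qed.

Lemma lym_sum_setT_ge m v :
  (forall k, k <= #|T| -> k != m -> v <= k`! * (#|T| - k)`!) ->
  #|F :&: ksubsets T m| * (m`! * (#|T| - m)`!) + #|F :\: ksubsets T m| * v
    <= lym_sum [set: T].
Proof.
move=> le_v; rewrite /lym_sum (eq_bigl (mem F)) => [|X]; last first.
  by rewrite subsetT andbT.
rewrite (big_setID (ksubsets T m)) /= cardsT leq_add //.
  rewrite -sum_nat_const leq_sum // => X.
  by rewrite !inE => /andP[_ /eqP->].
rewrite -sum_nat_const leq_sum // => X.
by rewrite !inE => /andP[neqm _]; rewrite le_v ?max_card.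
Qed.

End LYM.

(** * Complements, and two antichains weighed together *)

Lemma antichain_setC (T : finType) (F : {set {set T}}) :
  antichain F -> antichain [set ~: X | X in F].
Proof.
move=> antiF _ _ /imsetP[X XF ->] /imsetP[Y YF ->] neqXY.
by rewrite setCS antiF //; apply: contraNneq neqXY => ->.
Qed.

Section TwoAntichains.

Variables (T : finType) (A C : {set {set T}}).
Hypotheses (antiA : antichain A) (antiC : antichain C).
Hypothesis nsubAC : {in A & C, forall X Y : {set T}, ~~ (X \subset Y)}.
Let n := #|T|.
Hypothesis n_gt0 : 0 < n.

(* Only level [n./2] is weighed exactly; every other set weighs at least as much
   as one of the second largest level. *)
Lemma two_antichains_weight : exists2 a, a <= 'C(n, n./2) &
  a <= #|A| + #|C| /\
  a * (n./2`! * (n - n./2)`!) +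
   (#|A| + #|C| - a) * ((n./2.+1)`! * (n - n./2.+1)`!)
    <= lym_sum A setT + lym_sum C setT.
Proof.
have le_v k : k <= n -> k != n./2 ->
    (n./2.+1)`! * (n - n./2.+1)`! <= k`! * (n - k)`!.
  move=> lekn neqk; have := leq_bin_half_succ lekn neqk.
  have := bin_fact lekn; have lehn : n./2.+1 <= n by lia.
  have := bin_fact lehn; have := bin_gt0 n k; rewrite lekn.
  move: (_ * _`!) (_ * _`!) => v w; nia.
have := leq_add (lym_sum_setT_ge A le_v) (lym_sum_setT_ge C le_v).
set K := ksubsets T n./2.
have disjAC : [disjoint A :&: K & C :&: K].
  apply/pred0P => X /=; apply/negP; rewrite !inE => /andP[/andP[XA _]].
  by case/andP=> XC _; have := nsubAC XA XC; rewrite subxx.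
have le_a : #|A :&: K| + #|C :&: K| <= 'C(n, n./2).
  rewrite -card_ksubsets -/K; move: disjAC; rewrite -(leq_card_setU _ _).2.
  by move/eqP <-; rewrite -setIUl subset_leq_card ?subsetIr.
have := cardsID K A; have := cardsID K C => eqC eqA le_sum.
exists (#|A :&: K| + #|C :&: K|) => //; split; first by lia.
apply: leq_trans le_sum; rewrite -eqC -eqA addnACA addKn !mulnDl.
by rewrite addnACA.
Qed.

(** Keeping the excess over the bound on the left serves both uses: a positive excess contradicts
    LYM, and a zero excess forces equality in both LYM inequalities. *)
Lemma lym_sums_ge : 'C(n, n./2) + 'C(n, n./2.+1) <= #|A| + #|C| ->
  n`! + n`! + (#|A| + #|C| - ('C(n, n./2) + 'C(n, n./2.+1)))
    <= lym_sum A setT + lym_sum C setT.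
Proof.
have [a le_a [le_aAC le_sum] le_AC] := two_antichains_weight.
apply: leq_trans le_sum.
have lehn : n./2.+1 <= n by lia.
have lehn' : n./2 <= n by lia.
rewrite -{1}(bin_fact lehn') -(bin_fact lehn).
have := bin_fact lehn; rewrite -(bin_fact lehn').
have : 0 < (n./2.+1)`! * (n - n./2.+1)`! by rewrite muln_gt0 !fact_gt0.
have : 0 < 'C(n, n./2.+1) by rewrite bin_gt0.
have [leSM _] := leq_bin_half n; move: leSM le_a le_AC le_aAC.
move: 'C(_, _) 'C(_, _) (_ * _`!) (_ * _`!) (#|A| + #|C|) => M S u v f.
move=> leSM le_aM le_f le_af S_gt0 v_gt0 eqw.
have leuv : u <= v by nia.
(* Here [b] counts the sets missing from the middle level and [d] is the excess. After cancellation
   the claim is [b * u + d <= (b + d) * v], which follows from [u <= v] and [0 < v]. *)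
have [b defM] : exists b, M = a + b by exists (M - a); lia.
have [d deff] : exists d, f = M + S + d by exists (f - (M + S)); lia.
have -> : f - a = b + S + d by lia.
have -> : f - (M + S) = d by lia.
by rewrite defM !mulnDl; nia.
Qed.

Lemma two_antichains_le : #|A| + #|C| <= 'C(n, n./2) + 'C(n, n./2.+1).
Proof.
have := lym_sum_le antiA setT; have := lym_sum_le antiC setT; rewrite cardsT -/n.
by have := lym_sums_ge; lia.
Qed.

Lemma two_antichains_eq : #|A| + #|C| = 'C(n, n./2) + 'C(n, n./2.+1) ->
  exists i j, [/\ i <= n, j <= n, A = ksubsets T i & C = ksubsets T j].
Proof.
move=> eqAC; have := lym_sums_ge; rewrite eqAC leqnn subnn addn0 => /(_ isT).
have := lym_sum_le antiA setT; have := lym_sum_le antiC setT; rewrite cardsT -/n.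
move=> leC leA le_sum.
have [eqA eqC] : lym_sum A setT = n`! /\ lym_sum C setT = n`! by lia.
have level F : antichain F -> lym_sum F setT = n`! ->
    exists2 k, k <= n & F = ksubsets T k.
  move=> antiF; rewrite /n -cardsT => /(lym_sum_eq antiF)[k lek Fk].
  by exists k => //; apply/setP => X; rewrite inE Fk ?subsetT.
have [i lein ->] := level A antiA eqA; have [j lejn ->] := level C antiC eqC.
by exists i, j.
Qed.

Lemma two_antichains_eq_levels :
    #|A| + #|C| = 'C(n, n./2) + 'C(n, n./2.+1) ->
  (A = ksubsets T n./2.+1 /\ C = ksubsets T n./2) \/
  ~~ odd n /\ (A = ksubsets T n./2 /\ C = ksubsets T n./2.-1).
Proof.
move=> eqAC; have [i [j [lein lejn defA defC]]] := two_antichains_eq eqAC.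
have ltji : j < i.
  rewrite ltnNge; apply/negP => leij.
  have : j <= #|[set: T]| by rewrite cardsT.
  case/exists_subset_card=> Y _ cardY.
  have : i <= #|Y| by rewrite cardY.
  case/exists_subset_card=> X XY cardX.
  suff /negP : ~~ (X \subset Y) by [].
  by apply: nsubAC; rewrite ?defA ?defC inE ?cardX ?cardY.
move: eqAC; rewrite defA defC !card_ksubsets -/n.
have := leq_bin_half n => -[leSM eqSM].
have [eqi|neqi] := eqVneq i n./2.
  have neqj : j != n./2 by lia.
  rewrite eqi => /addnI /(bin_half_succ_inj lejn neqj)[]; first by lia.
  by right; split; [|split; congr ksubsets]; lia.
have := leq_bin_half_succ lein neqi.
have [eqj|neqj] := eqVneq j n./2.
  rewrite eqj => _; rewrite addnC => /addnI /(bin_half_succ_inj lein neqi)[->|].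
    by left.
  by lia.
(* With both ranks off [n./2], the sum forces the two largest coefficients to be equal, so [n] is
   odd. Then both ranks must be [n./2.+1], against [j < i]. *)
have := leq_bin_half_succ lejn neqj => lej lei eqS.
have [] := bin_half_succ_inj lein neqi; first by lia.
  have [] := bin_half_succ_inj lejn neqj; first by lia.
    by lia.
  by have oddn : odd n; [rewrite -eqSM; apply/eqP |]; lia.
by have [] := bin_half_succ_inj lejn neqj; lia.
Qed.

End TwoAntichains.

Theorem theorem1p4 (n : nat) (A B : {set {set 'I_n}})
    (hn : 3 <= n) (hA : antichain A) (hB : antichain B)
    (hAB : cross_intersecting A B) :
  #|A| + #|B| <= 'C(n, (n + 1)./2) + 'C(n, uphalf (n + 1)) /\
  (#|A| + #|B| = 'C(n, (n + 1)./2) + 'C(n, uphalf (n + 1)) <->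
   [set A; B] =
     [set ksubsets 'I_n (n + 1)./2; ksubsets 'I_n (uphalf (n + 1))]).
Proof.
set p := (n + 1)./2; set q := uphalf (n + 1).
have n_gt0 : 0 < #|'I_n| by rewrite card_ord; lia.
(* A set meets [Y] exactly when it is not contained in [~: Y], so cross-intersection becomes
   non-containment. *)
pose C := [set ~: X | X in B].
have cardC : #|C| = #|B| by rewrite card_imset //; apply: setC_inj.
have defB : B = [set ~: X | X in C].
  by rewrite -imset_comp (eq_imset _ (@setCK _)) imset_id.
have nsubAC : {in A & C, forall X Y : {set 'I_n}, ~~ (X \subset Y)}.
  move=> X _ XA /imsetP[Y YB ->].
  by rewrite -disjoints_subset -setI_eq0; apply: hAB.
have antiC : antichain C by apply: antichain_setC.
(* For odd [n], [p] and [q] are both [n./2.+1], and the two middle coefficients agree; for even [n]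
   they are [n./2] and [n./2.+1]. *)
have binE : 'C(n, p) + 'C(n, q) = 'C(n, n./2) + 'C(n, n./2.+1).
  rewrite /p /q; have [oddn|evenn] := boolP (odd n).
    have -> : 'C(n, n./2) = 'C(n, n./2.+1).
      by apply/esym/eqP; rewrite (leq_bin_half n).2.
    by congr ('C(n, _) + 'C(n, _)); lia.
  by congr ('C(n, _) + 'C(n, _)); lia.
have leAB := two_antichains_le hA antiC nsubAC n_gt0.
have eqAB := two_antichains_eq_levels hA antiC nsubAC n_gt0.
rewrite cardC card_ord in leAB eqAB; rewrite binE; split=> //; split.
  have setC_level k : k <= n ->
      [set ~: X | X in ksubsets 'I_n k] = ksubsets 'I_n (n - k).
    by move=> lekn; rewrite setC_ksubsets card_ord.
  (* For even [n] the two outcomes are the two orders of the pair; for odd [n] only the first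
     occurs, and there [A = B]. *)
  case/eqAB=> [|[evenn]] [defA defC]; rewrite defB defA defC setC_level;
    try lia.
    by rewrite setUC; congr [set ksubsets _ _; ksubsets _ _]; lia.
  by congr [set ksubsets _ _; ksubsets _ _]; lia.
have card_level k : #|ksubsets 'I_n k| = 'C(n, k).
  by rewrite card_ksubsets card_ord.
move=> eqS; rewrite -binE -!card_level.
(* The pairs are unordered and may collapse to one element, so membership is used in both
   directions: each level must also occur among [A] and [B]. *)
have : A \in [set ksubsets 'I_n p; ksubsets 'I_n q] by rewrite -eqS set21.
have : B \in [set ksubsets 'I_n p; ksubsets 'I_n q] by rewrite -eqS set22.
have : ksubsets 'I_n p \in [set A; B] by rewrite eqS set21.
have : ksubsets 'I_n q \in [set A; B] by rewrite eqS set22.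
rewrite !inE => /orP[]/eqP-> /orP[]/eqP-> /orP[]/eqP E1 /orP[]/eqP E2.
all: by rewrite ?E1 ?E2 ?E1 // addnC.
Qed.
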